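(* Let $\rho$ and $\sigma$ be positive operators on a finite dimensional Hilbert space $\mathcal{H}$ that are not mutually singular ($\sigma\not\perp\rho$). Let $\mathcal{H}=\mathcal{H}_1\oplus\mathcal{H}_2\oplus\mathcal{H}_3$ be the orthogonal decomposition with $\mathcal{H}_1:=\ker(\sigma\!\downharpoonleft_{\mathrm{supp}\,\rho})$, $\mathcal{H}_2:=\mathrm{supp}(\sigma\!\downharpoonleft_{\mathrm{supp}\,\rho})$, $\mathcal{H}_3:=\ker\rho$, relative to which $$\rho=\begin{pmatrix}\rho_2&\rho_1&0\\ \rho_1^*&\rho_0&0\\ 0&0&0\end{pmatrix},\qquad \sigma=\begin{pmatrix}0&0&0\\ 0&\sigma_0&\alpha\\ 0&\alpha^*&\beta\end{pmatrix},\qquad \begin{pmatrix}\rho_2&\rho_1\\ \rho_1^*&\rho_0\end{pmatrix}>0,\quad \sigma_0>0.$$ Then the decomposition $$\sigma=\sigma^{ac}+\sigma^{\perp}\qquad(\sigma^{ac}\ll\rho,\ \ \sigma^{\perp}\perp\rho)$$ into positive operators $\sigma^{ac},\sigma^\perp$ is uniquely given by $$\sigma^{ac}=\begin{pmatrix}0&0&0\\ 0&\sigma_0&\alpha\\ 0&\alpha^*&\alpha^*\sigma_0^{-1}\alpha\end{pmatrix},\qquad \sigma^{\perp}=\begin{pmatrix}0&0&0\\ 0&0&0\\ 0&0&\beta-\alpha^*\sigma_0^{-1}\alpha\end{pmatrix}.$$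
   Context: ''Positive'' means positive semidefinite ($A\ge 0$); $A>0$ means strictly positive. For a positive operator $\rho$ on $\mathcal{H}$, $\mathrm{supp}\,\rho:=(\ker\rho)^\perp$, and for a positive operator $\sigma$ the excision of $\sigma$ relative to $\rho$ is the operator $\sigma\!\downharpoonleft_{\mathrm{supp}\,\rho}:=\iota_\rho^*\,\sigma\,\iota_\rho$ on $\mathrm{supp}\,\rho$, where $\iota_\rho:\mathrm{supp}\,\rho\hookrightarrow\mathcal{H}$ is the inclusion. One says $\rho$ is singular with respect to $\sigma$, $\rho\perp\sigma$, if $\sigma\!\downharpoonleft_{\mathrm{supp}\,\rho}=0$ (this relation is symmetric), and $\rho$ is absolutely continuous with respect to $\sigma$, $\rho\ll\sigma$, if $\sigma\!\downharpoonleft_{\mathrm{supp}\,\rho}>0$ (for the zero operator both conditions hold vacuously). If $\mathcal{H}_1=\{0\}$ (resp. $\mathcal{H}_3=\{0\}$) the first (resp. third) rows and columns of the block matrices are to be ignored. That $\rho,\sigma$ have the displayed block form follows from the definition of $\mathcal{H}_1,\mathcal{H}_2,\mathcal{H}_3$. *)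

(* Defs.v *)
From HB Require Import structures.
From mathcomp Require Import all_boot all_order all_algebra.
From mathcomp Require Import reals complex.

Set Implicit Arguments.
Unset Strict Implicit.
Unset Printing Implicit Defensive.

Import Order.TTheory GRing.Theory Num.Theory.
Local Open Scope ring_scope.

Declare Scope hilbert_scope.
Delimit Scope hilbert_scope with hilb.

(* Finite-dimensional Hilbert spaces; the inner product is linear in its first
   argument, as for every {dot _ for _} of the library. *)
HB.mixin Record Vector_isHilbert (C : numClosedFieldType) H of Vector C H := {
  hdot : {dot H for (@Num.conj C)}
}.

#[short(type="fdHilbertType")]
HB.structure Definition FdHilbert (C : numClosedFieldType) :=
  { H of Vector C H & Vector_isHilbert C H }.

Arguments hdot {C s}.

Notation "''[' u , v ]" := (hdot u v) : hilbert_scope.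
Local Open Scope hilbert_scope.

Section Subspace.
Variables (C : numClosedFieldType) (H : fdHilbertType C) (V : {vspace H}).
Implicit Types u v : subvs_of V.

Definition sub_hdot u v : C := '[vsval u, vsval v].

Fact sub_hdot_bilinear :
  bilinear_for *%R (Num.conj \; *%R : GRing.Scale.law C C) sub_hdot.
Proof.
by split=> [v|u] a x y; rewrite /sub_hdot linearP ?linearPl ?linearPr.
Qed.
HB.instance Definition _ := bilinear_isBilinear.Build _ _ _ _ _ _ sub_hdot
  sub_hdot_bilinear.

Fact sub_hdot_hermitian u v :
  sub_hdot u v = (-1) ^+ false * (sub_hdot v u)^*.
Proof. exact: hermC. Qed.
HB.instance Definition _ := isHermitianSesquilinear.Build _ _ _ _ sub_hdot
  sub_hdot_hermitian.

Fact sub_hdot_gt0 u : u != 0 -> 0 < sub_hdot u u.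
Proof. by move=> u0; rewrite dnorm_gt0. Qed.
HB.instance Definition _ := isDotProduct.Build _ _ sub_hdot sub_hdot_gt0.

HB.instance Definition _ := Vector_isHilbert.Build C (subvs_of V) sub_hdot.

End Subspace.

Section DirectSum.
Variables (C : numClosedFieldType) (U V : fdHilbertType C).
Implicit Types x y : (U * V)%type.

Definition pair_hdot x y : C := '[x.1, y.1] + '[x.2, y.2].

Fact pair_hdot_bilinear :
  bilinear_for *%R (Num.conj \; *%R : GRing.Scale.law C C) pair_hdot.
Proof.
by split=> [z|z] a x y; rewrite /pair_hdot /= ?linearPl ?linearPr /= mulrDr
  addrACA.
Qed.
HB.instance Definition _ := bilinear_isBilinear.Build _ _ _ _ _ _ pair_hdot
  pair_hdot_bilinear.

Fact pair_hdot_hermitian x y :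
  pair_hdot x y = (-1) ^+ false * (pair_hdot y x)^*.
Proof.
by rewrite /pair_hdot expr0 mul1r rmorphD /=; congr (_ + _);
  rewrite hermC expr0 mul1r.
Qed.
HB.instance Definition _ := isHermitianSesquilinear.Build _ _ _ _ pair_hdot
  pair_hdot_hermitian.

Fact pair_hdot_gt0 x : x != 0 -> 0 < pair_hdot x x.
Proof.
move=> x0; rewrite lt_def addr_ge0 ?dnorm_ge0 // andbT.
rewrite paddr_eq0 ?dnorm_ge0 // !dnorm_eq0.
by apply: contraNN x0 => /andP[/eqP x1 /eqP x2]; case: x x1 x2 => /= ? ? -> ->.
Qed.
HB.instance Definition _ := isDotProduct.Build _ _ pair_hdot pair_hdot_gt0.

HB.instance Definition _ :=
  Vector_isHilbert.Build C (U * V)%type pair_hdot.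

End DirectSum.

Section Adjoint.
Variables (C : numClosedFieldType) (U W : fdHilbertType C).
Implicit Type f : 'Hom(U, W).

Let dual_coord (w : W) f : 'rV[C]_(\dim {:U}) :=
  \row_i '[w, f (vbasis {:U})`_i].

Fact dual_coord_is_linear f : linear (dual_coord^~ f).
Proof. by move=> a w1 w2; apply/rowP => i; rewrite !mxE linearPl. Qed.

Definition dual_coords f : 'Hom(W, 'rV[C]_(\dim {:U})) :=
  linfun (dual_coord^~ f).

Lemma dual_coordsE f w i : dual_coords f w 0 i = '[w, f (vbasis {:U})`_i].
Proof.
pose L := GRing.isLinear.Build _ _ _ _ _ (dual_coord_is_linear f).
pose F : {linear W -> 'rV[C]_(\dim {:U})} := HB.pack (dual_coord^~ f) L.
by rewrite -[dual_coords f]/(linfun F) lfunE mxE.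
Qed.

End Adjoint.

(* f^* w is the vector of U with <f^* w, e_i> = <w, f e_i> on the basis
   (e_i)_i of U; adjP below is its characteristic property. *)
Definition adj (C : numClosedFieldType) (U W : fdHilbertType C)
    (f : 'Hom(U, W)) : 'Hom(W, U) :=
  ((dual_coords (\1%VF : 'End(U)))^-1 \o dual_coords f)%VF.

Lemma dual_coords_inj (C : numClosedFieldType) (U : fdHilbertType C) :
  lker (dual_coords (\1%VF : 'End(U))) = 0%VS.
Proof.
apply/eqP; rewrite -subv0; apply/subvP => u; rewrite memv_ker memv0 => /eqP u0.
rewrite -(dnorm_eq0 (@hdot C U)) {2}(coord_vbasis (memvf u)) linear_sumr.
rewrite big1 // => i _; rewrite linearZr /=.
have := dual_coordsE (\1%VF : 'End(U)) u i.
by rewrite u0 mxE id_lfunE => <-; rewrite mulr0.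
Qed.

Lemma adjP (C : numClosedFieldType) (U W : fdHilbertType C) (f : 'Hom(U, W))
  (u : U) (w : W) : '[f u, w] = '[u, adj f w].
Proof.
have k0 := @dual_coords_inj C U.
have onto : limg (dual_coords (\1%VF : 'End(U))) = fullv.
  apply/eqP; rewrite eqEdim subvf /=.
  have := limg_ker_dim (dual_coords (\1%VF : 'End(U))) fullv.
  by rewrite k0 capv0 dimv0 add0n => ->; rewrite dimvf /dim /= mul1n.
have key (i : 'I_(\dim {:U})) : '[adj f w, (vbasis {:U})`_i] = '[w, f (vbasis {:U})`_i].
  have := dual_coordsE (\1%VF : 'End(U)) (adj f w) i.
  rewrite id_lfunE => <-.
  by rewrite /adj comp_lfunE limg_lfunVK ?onto ?memvf // dual_coordsE.
rewrite hermC [RHS]hermC !expr0 !mul1r; congr (_^*).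
rewrite (coord_vbasis (memvf u)) !linear_sum /=.
by apply: eq_bigr => i _; rewrite linearZ !linearZr /= key.
Qed.

Section Operators.
Variables (C : numClosedFieldType) (H : fdHilbertType C).
Implicit Types (A rho sigma : 'End(H)) (V W : {vspace H}).

Definition positive A := forall v, 0 <= '[A v, v].
Definition strictly_positive A := forall v, v != 0 -> 0 < '[A v, v].

Definition supp A : {vspace H} := orthov (@hdot C H) (lker A).

Definition incl V : 'Hom(subvs_of V, H) := linfun vsval.

Definition block V W A : 'Hom(subvs_of W, subvs_of V) :=
  (adj (incl V) \o A \o incl W)%VF.

Definition excision sigma rho : 'End(subvs_of (supp rho)) :=
  block (supp rho) (supp rho) sigma.

End Operators.

Section Relations.
Variables (C : numClosedFieldType) (H : fdHilbertType C).
Implicit Types rho sigma : 'End(H).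

Definition singular rho sigma := excision sigma rho = 0.

Definition abs_cont rho sigma := strictly_positive (excision sigma rho).

End Relations.

Section BlockOperators.
Variable C : numClosedFieldType.

Section TwoByTwo.
Variables U V : fdHilbertType C.
Variables (a11 : 'End(U)) (a12 : 'Hom(V, U)) (a21 : 'Hom(U, V)) (a22 : 'End(V)).

Let blockop2_fun (x : (U * V)%type) : (U * V)%type :=
  (a11 x.1 + a12 x.2, a21 x.1 + a22 x.2).

Definition blockop2 : 'End((U * V)%type) := linfun blockop2_fun.

Fact blockop2_is_linear : linear blockop2_fun.
Proof.
by move=> a x y; congr pair; rewrite !linearP /= scalerDr addrACA.
Qed.

Lemma blockop2E x : blockop2 x = (a11 x.1 + a12 x.2, a21 x.1 + a22 x.2).
Proof.
pose L := GRing.isLinear.Build _ _ _ _ _ blockop2_is_linear.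
pose F : {linear (U * V)%type -> (U * V)%type} := HB.pack blockop2_fun L.
by rewrite -[blockop2]/(linfun F) lfunE.
Qed.

End TwoByTwo.

(* The operator on H with the given 3 x 3 block matrix relative to the
   subspaces V1, V2, V3; if Vi = 0 then row i and column i contribute 0. *)
Definition blockop3 (H : fdHilbertType C) (V1 V2 V3 : {vspace H})
    (a11 : 'Hom(subvs_of V1, subvs_of V1)) (a12 : 'Hom(subvs_of V2, subvs_of V1))
    (a13 : 'Hom(subvs_of V3, subvs_of V1))
    (a21 : 'Hom(subvs_of V1, subvs_of V2)) (a22 : 'Hom(subvs_of V2, subvs_of V2))
    (a23 : 'Hom(subvs_of V3, subvs_of V2))
    (a31 : 'Hom(subvs_of V1, subvs_of V3)) (a32 : 'Hom(subvs_of V2, subvs_of V3))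
    (a33 : 'Hom(subvs_of V3, subvs_of V3)) : 'End(H) :=
  let lift V W (a : 'Hom(subvs_of W, subvs_of V)) : 'End(H) :=
    (incl V \o a \o adj (incl W))%VF in
  lift V1 V1 a11 + lift V1 V2 a12 + lift V1 V3 a13 +
  (lift V2 V1 a21 + lift V2 V2 a22 + lift V2 V3 a23) +
  (lift V3 V1 a31 + lift V3 V2 a32 + lift V3 V3 a33).

Definition orthogonal_decomp (H : fdHilbertType C) (V1 V2 V3 : {vspace H}) :=
  [/\ (V1 + V2 + V3)%VS = fullv,
      {in V1 & V2, forall u v, '[u, v] = 0},
      {in V1 & V3, forall u v, '[u, v] = 0}
    & {in V2 & V3, forall u v, '[u, v] = 0}].

End BlockOperators.

Section Decomposition.
Variables (C : numClosedFieldType) (H : fdHilbertType C) (rho sigma : 'End(H)).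

Definition H1 : {vspace H} :=
  (incl (supp rho) @: lker (excision sigma rho))%VS.
Definition H2 : {vspace H} :=
  (incl (supp rho) @: supp (excision sigma rho))%VS.
Definition H3 : {vspace H} := lker rho.

End Decomposition.

(* Main.v *)
Require Import Defs.
From HB Require Import structures.
From mathcomp Require Import all_boot all_order all_algebra.
From mathcomp Require Import reals complex ring.

(** The operators sigma and rho are compared through two reformulations. For
positive operators, singularity of sigma with respect to rho says that sigma
vanishes on supp rho ([singularP]), and absolute continuity of sigma with
respect to rho says that supp sigma meets ker rho trivially ([abs_contP]).
Both rest on the fact that a positive operator A kills every v with
<A v, v> = 0 ([positive_isotropic]).

The block forms. Since <sigma x, x> = 0 forces sigma x = 0, the space H1 is
supp rho meet ker sigma ([H1E]) and H2 is its orthogonal complement in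
supp rho ([H2E]). So sigma vanishes on H1, rho vanishes on H3, and
selfadjointness transports these zeros to the symmetric blocks ([rho_blockE], [sigma_blockE]).

Existence. With y = x2 + sigma0^-1 (alpha x3), the candidate sigma^ac sends
(x1, x2, x3) to (0, sigma0 y, alpha^* y), so its quadratic form is
<sigma0 y, y> >= 0. It kills the vectors k(x3) = (0, - sigma0^-1 (alpha x3), x3);
hence sigma and sigma^perp agree on them, and
<sigma^perp x, x> = <sigma k(x3), k(x3)> >= 0. The same vectors give
absolute continuity: an element x3 of ker rho = H3 lying in supp sigma^ac is
orthogonal to k(x3), whose third component is x3 itself, so it is 0.

Uniqueness ([lebesgue_unique]) needs no blocks. If a is absolutely continuous
with respect to rho, every u is k + y with a k = 0 and y in supp rho
([ac_decomposition]). Let a' be the absolutely continuous part of another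
decomposition. On supp rho both a and a' coincide with sigma, whence
<a' u, u> = <a u, u> + <a' k, k> >= <a u, u>. By symmetry the quadratic forms
of a and a' are equal, and so are a and a'. *)

Set Implicit Arguments.
Unset Strict Implicit.
Unset Printing Implicit Defensive.

Import Order.TTheory GRing.Theory Num.Theory.
Local Open Scope ring_scope.
Local Open Scope hilbert_scope.

(** * Adjoints, orthogonal complements and blocks *)

Section Hilbert.
Variables (C : numClosedFieldType).
Implicit Types E F H : fdHilbertType C.

Lemma hdotC H (u v : H) : '[u, v] = ('[v, u])^*.
Proof. by rewrite hermC expr0 mul1r. Qed.

Lemma hdot_eq0C H (u v : H) : '[u, v] = 0 -> '[v, u] = 0.
Proof. by move=> uv0; rewrite hdotC uv0 rmorph0. Qed.

Lemma hdot_self_eq0 H (u : H) : '[u, u] = 0 -> u = 0.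
Proof. by move/eqP; rewrite dnorm_eq0 => /eqP. Qed.

Lemma hdot_injl H (u v : H) : (forall w, '[u, w] = '[v, w]) -> u = v.
Proof.
move=> uv; apply/eqP; rewrite -subr_eq0; apply/eqP/hdot_self_eq0.
by rewrite linearBl /= uv subrr.
Qed.

Lemma hdot_injr H (u v : H) : (forall w, '[w, u] = '[w, v]) -> u = v.
Proof. by move=> uv; apply: hdot_injl => w; rewrite hdotC uv -hdotC. Qed.

Lemma adjPl E F (f : 'Hom(E, F)) u w : '[adj f w, u] = '[w, f u].
Proof. by rewrite hdotC -adjP -hdotC. Qed.

Lemma adj_unique E F (f : 'Hom(E, F)) (g : 'Hom(F, E)) :
  (forall u w, '[f u, w] = '[u, g w]) -> adj f = g.
Proof. by move=> fg; apply/lfunP => w; apply: hdot_injr => u; rewrite -adjP. Qed.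

Section OneSpace.
Variable H : fdHilbertType C.
Implicit Types (V W : {vspace H}) (A : 'End(H)) (u v w : H).

Lemma inclE V x : incl V x = vsval x.
Proof. by rewrite lfunE. Qed.

(** The adjoint of the inclusion of V is the orthogonal projection onto V,
with values in V: this lemma gives it on V, [adj_incl_orthov] on the
orthogonal complement. *)
Lemma adj_inclK V (x : subvs_of V) : adj (incl V) (vsval x) = x.
Proof. by apply: hdot_injl => y; rewrite adjPl inclE. Qed.

(** Stated for [hdot] itself rather than for its underlying hermitian form, so
that later rewriting sees the inner product of H. *)
Lemma memv_orthovP V u :
  reflect {in V, forall v, '[u, v] = 0} (u \in orthov hdot V).
Proof. exact: mem_orthovP. Qed.

Lemma adj_incl_orthov V u : u \in orthov hdot V -> adj (incl V) u = 0.
Proof.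
move=> /memv_orthovP u0; apply: hdot_injl => y.
by rewrite adjPl inclE linear0l u0 ?subvsP.
Qed.

Lemma orthov_split V u :
  exists v w, [/\ v \in V, w \in orthov hdot V & u = v + w].
Proof.
exists (vsval (adj (incl V) u)), (u - vsval (adj (incl V) u)).
split; first exact: subvsP; last by rewrite addrC subrK.
apply/memv_orthovP => v vV; have vE : v = incl V (vsproj V v).
  by rewrite inclE vsprojK.
by rewrite vE linearBl /= -adjPl -(inclE (adj _ _)) -adjPl inclE adj_inclK subrr.
Qed.

Lemma orthovK V : orthov hdot (orthov hdot V) = V.
Proof.
apply/eqP; rewrite eqEsubv -orthov_sym subvv andbT; apply/subvP => u.
have [v [w [vV wV ->]]] := orthov_split V u => /memv_orthovP /(_ w wV).
rewrite linearDl /= (hdot_eq0C (memv_orthovP _ _ wV v vV)) add0r.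
by move/hdot_self_eq0 ->; rewrite addr0.
Qed.

Lemma blockE V W A x : block V W A x = adj (incl V) (A (vsval x)).
Proof. by rewrite /block 2!comp_lfunE inclE. Qed.

Lemma hdot_block V W A x y :
  '[block V W A x, y] = '[A (vsval x), vsval y].
Proof. by rewrite blockE adjPl inclE. Qed.

Lemma adj_block V W A :
  (forall u v, '[A u, v] = '[u, A v]) -> adj (block V W A) = block W V A.
Proof.
move=> sa; apply: adj_unique => x y.
by rewrite hdot_block sa [RHS]hdotC hdot_block -hdotC.
Qed.

End OneSpace.
End Hilbert.

Arguments memv_orthovP {C H V u}.

(** * Positive operators and their supports *)

Section Positive.
Variables (C : numClosedFieldType) (H : fdHilbertType C).
Implicit Types (A rho sigma : 'End(H)).

(** Polarization: the reality of the quadratic form of A at u + v and at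
u + 'i v gives two equations in <A u, v> and <A v, u> whose only solutions are
conjugate pairs. *)
Lemma positive_selfadj A :
  positive A -> forall u v, '[A u, v] = '[u, A v].
Proof.
move=> A0 u v; rewrite [RHS]hdotC.
have re w : ('[A w, w])^* = '[A w, w] by rewrite geC0_conj.
have := re (u + v); have := re (u + 'i *: v).
rewrite !(linearD A) !linearZ /= !linearDl /= !linearDr /= !linearZl /=.
rewrite !linearZr /= !rmorphD /= !rmorphM /= !re !conjCK !conjCi.
set a := '[A u, v]; set b := '[A v, u]; set p := '[A u, u].
set q := '[A v, v].
move=> e1 e2.
have d1 : a - b^* = a^* - b.
  apply/eqP; rewrite -subr_eq0; apply/eqP.
  have -> : a - b^* - (a^* - b) =
    (p + a + (b + q)) - (p + a^* + (b^* + q)) by ring.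
  by rewrite e2 subrr.
have d2 : a - b^* = - (a^* - b).
  apply: (mulfI (neq0Ci C)); apply/eqP; rewrite -subr_eq0; apply/eqP.
  have -> : 'i * (a - b^*) - 'i * - (a^* - b) =
    (p + 'i * a^* + (- 'i * b^* + - 'i * ('i * q))) -
    (p + - 'i * a + ('i * b + 'i * (- 'i * q))) by ring.
  by rewrite e1 subrr.
by apply/eqP; rewrite -subr_eq0 -eqNr {1}d1 -d2.
Qed.

(** Cauchy-Schwarz for the semi-inner product <A x, y>: v is at the minimum 0
of the quadratic form of A, so its derivative, along A v in particular,
vanishes at v. *)
Lemma positive_isotropic A v : positive A -> '[A v, v] = 0 -> A v = 0.
Proof.
move=> A0 v0; set w := A v; set b := '[w, w]; set c := '[A w, w].
have b0 : 0 <= b by apply: dnorm_ge0.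
have c0 : 0 <= c by apply: A0.
have c1 : 0 <= c + 1 by rewrite addr_ge0.
(* Up to scale this is v - t w with t = b / (c + 1): there the quadratic form
   is - b^2 (c + 2) / (c + 1)^2, which is negative unless b = 0. *)
have := A0 ((c + 1) *: v + (- b) *: w).
have bC : (- b)^* = - b by rewrite rmorphN /= (geC0_conj b0).
rewrite (linearD A) !linearZ /= -/w !linearDl !linearDr !linearZl !linearZr /=.
rewrite (positive_selfadj A0 w v) -/w v0 -/b -/c bC (geC0_conj c1).
have -> : (c + 1) * ((c + 1) * 0) + (c + 1) * (- b * b) +
  (- b * ((c + 1) * b) + - b * (- b * c)) = - (b ^+ 2 * (c + 2)) by ring.
rewrite oppr_ge0 pmulr_lle0 ?ltr_wpDl // => bb.
apply: hdot_self_eq0; apply/eqP; rewrite -/b -[_ == 0](expf_eq0 _ 2%N).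
by rewrite eq_le bb exprn_ge0.
Qed.

Lemma strictly_positive_lker0 A : strictly_positive A -> lker A == 0%VS.
Proof.
move=> A0; rewrite -subv0; apply/subvP => v; rewrite memv_ker memv0 => /eqP Av.
by apply: contraT => /A0; rewrite Av linear0l ltxx.
Qed.

Lemma supp_ker0 A v : v \in supp A -> A v = 0 -> v = 0.
Proof.
move=> vS Av; apply: hdot_self_eq0; apply: (memv_orthovP vS).
by rewrite memv_ker Av.
Qed.

Lemma supp_split A u : exists v w, [/\ v \in supp A, A w = 0 & u = v + w].
Proof.
have [w [v [wK vS ->]]] := orthov_split (lker A) u.
by exists v, w; split; rewrite // 1?addrC //; apply/eqP; rewrite -memv_ker.
Qed.

Lemma img_supp A v : positive A -> A v \in supp A.
Proof.
move=> A0; apply/memv_orthovP => w; rewrite memv_ker => /eqP Aw.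
by rewrite positive_selfadj // Aw linear0r.
Qed.

Lemma hdot_positive_supp A v :
  positive A -> v \in supp A -> v != 0 -> 0 < '[A v, v].
Proof.
move=> A0 vS v0; rewrite lt_def A0 andbT; apply: contraNneq v0 => Avv.
by apply/eqP/(supp_ker0 vS)/positive_isotropic.
Qed.

(** * Singularity, absolute continuity and uniqueness *)

(** If rho vanishes on supp sigma, which contains the range of sigma, then
rho sigma x = 0; for x in supp rho = (ker rho)^perp this gives
<sigma x, x> = 0. Conversely the range of rho lies in supp rho, so sigma rho = 0,
and this says that the range of rho is orthogonal to supp sigma. *)
Lemma singularP sigma rho : positive rho -> positive sigma ->
  singular sigma rho <-> {in supp rho, forall x, sigma x = 0}.
Proof.
move=> r0 s0; split=> [sing x xS|sx].
  have rsx : rho (sigma x) = 0.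
    apply: positive_isotropic => //.
    have := hdot_block rho (vsproj (supp sigma) (sigma x))
      (vsproj (supp sigma) (sigma x)).
    rewrite -/(excision _ _) sing zero_lfunE linear0l.
    by rewrite vsprojK ?img_supp // => <-.
  apply: positive_isotropic => //; apply: hdot_eq0C.
  by apply: (memv_orthovP xS); rewrite memv_ker rsx.
apply/lfunP => x; apply: hdot_injl => y.
rewrite zero_lfunE linear0l hdot_block; apply: hdot_eq0C.
apply: (memv_orthovP (subvsP y)).
by rewrite memv_ker sx // img_supp.
Qed.

Lemma abs_contP sigma rho : positive rho ->
  abs_cont sigma rho <-> {in supp sigma, forall x, rho x = 0 -> x = 0}.
Proof.
move=> r0; split=> [ac x xS rx|sr x x0].
  have := ac (vsproj (supp sigma) x).
  rewrite hdot_block vsprojK // rx linear0l ltxx => h.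
  suff : vsproj (supp sigma) x = 0 by move/(congr1 vsval); rewrite vsprojK.
  by apply: contraTeq isT => /h.
rewrite hdot_block lt_def r0 andbT; apply: contraNneq x0 => rx.
apply/eqP/val_inj => /=; apply: sr; first exact: subvsP.
exact: positive_isotropic.
Qed.

(** The orthogonal complement of ker sigma + supp rho is
supp sigma meet ker rho, which absolute continuity makes trivial. *)
Lemma ac_decomposition sigma rho u : positive rho -> abs_cont sigma rho ->
  exists k y, [/\ sigma k = 0, y \in supp rho & u = k + y].
Proof.
move=> r0 /(abs_contP _ r0) sr.
suff : u \in (lker sigma + supp rho)%VS.
  case/memv_addP => k kK [y yS ->]; exists k, y; split=> //.
  by apply/eqP; rewrite -memv_ker.
suff -> : (lker sigma + supp rho)%VS = fullv by rewrite memvf.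
rewrite -[LHS](@orthovK _ H) -(@orthov0 _ _ _ _ (@hdot C H)); congr orthov.
apply/eqP; rewrite -subv0; apply/subvP => x.
rewrite memvE orthovD -!memvE => /andP[xs]; rewrite /supp orthovK memv_ker.
by rewrite memv0 => /eqP /(sr x xs) ->.
Qed.

(** By [ac_decomposition] for a, <a' u, u> exceeds <a u, u> by <a' k, k>, where
k is the component of u in ker a. Exchanging a and a' gives equality of the
quadratic forms. *)
Lemma lebesgue_unique rho a p a' p' :
  positive rho ->
  positive a -> positive p -> abs_cont a rho -> singular p rho ->
  positive a' -> positive p' -> abs_cont a' rho -> singular p' rho ->
  a + p = a' + p' -> a = a'.
Proof.
move=> r0 a0 p0 ac /(singularP r0 p0) sp a0' p0' ac' /(singularP r0 p0') sp' e.
have eqS x : x \in supp rho -> a x = a' x.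
  move=> xS; have := congr1 (fun f : 'End(H) => f x) e.
  by rewrite !add_lfunE sp // sp' // !addr0.
have le b b' u : positive b -> positive b' -> abs_cont b rho ->
    (forall x, x \in supp rho -> b x = b' x) -> '[b u, u] <= '[b' u, u].
  move=> b0 b0' bc bb; have [k [y [bk yS ->]]] := ac_decomposition u r0 bc.
  have b'y w : '[b' w, y] = '[b w, y].
    by rewrite positive_selfadj // -bb // -positive_selfadj.
  rewrite (linearD b) (linearD b') /= bk add0r linearDl !linearDr /= -(bb y yS).
  by rewrite b'y bk linear0l addr0 lerDr.
pose d := a - a'.
have d0 u : '[d u, u] = 0.
  rewrite add_lfunE opp_lfunE linearBl /=; apply/eqP; rewrite subr_eq0 eq_le.
  by rewrite !le // => x /eqS.
have dp : positive d by move=> u; rewrite d0.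
apply/eqP; rewrite -subr_eq0; apply/eqP/lfunP => u.
by rewrite zero_lfunE; apply: positive_isotropic.
Qed.

End Positive.

(** * Block operators of an orthogonal decomposition *)

Section OrthogonalDecomposition.
Variables (C : numClosedFieldType) (H : fdHilbertType C) (V1 V2 V3 : {vspace H}).
Hypothesis od : orthogonal_decomp V1 V2 V3.

Lemma adj_incl_ortho (V W : {vspace H}) (x : subvs_of W) :
  {in W & V, forall u v, '[u, v] = 0} -> adj (incl V) (vsval x) = 0.
Proof.
move=> WV; apply: adj_incl_orthov; apply/memv_orthovP => v vV.
by rewrite WV ?subvsP.
Qed.

Lemma adj_incl_sum (x1 : subvs_of V1) (x2 : subvs_of V2) (x3 : subvs_of V3) :
  let x := vsval x1 + vsval x2 + vsval x3 in
  [/\ adj (incl V1) x = x1, adj (incl V2) x = x2 & adj (incl V3) x = x3].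
Proof.
have [_ o12 o13 o23] := od.
have sw (V W : {vspace H}) : {in V & W, forall u v, '[u, v] = 0} ->
    {in W & V, forall u v, '[u, v] = 0}.
  by move=> VW u v uW vV; rewrite hdot_eq0C ?VW.
have o21 := sw _ _ o12; have o31 := sw _ _ o13; have o32 := sw _ _ o23.
split; rewrite !linearD /= adj_inclK.
- by rewrite (adj_incl_ortho _ o21) (adj_incl_ortho _ o31) !addr0.
- by rewrite (adj_incl_ortho _ o12) (adj_incl_ortho _ o32) add0r addr0.
- by rewrite (adj_incl_ortho _ o13) (adj_incl_ortho _ o23) !add0r.
Qed.

Lemma odecomp_split u : exists x1 x2 x3,
  u = vsval (x1 : subvs_of V1) + vsval (x2 : subvs_of V2)
      + vsval (x3 : subvs_of V3).
Proof.
have [full _ _ _] := od.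
have : u \in (V1 + V2 + V3)%VS by rewrite full memvf.
case/memv_addP => w /memv_addP [u1 u1V [u2 u2V ->]] [u3 u3V ->].
exists (vsproj V1 u1), (vsproj V2 u2), (vsproj V3 u3).
by rewrite !vsprojK.
Qed.

Lemma hdot_odecomp (x1 y1 : subvs_of V1) (x2 y2 : subvs_of V2)
    (x3 y3 : subvs_of V3) :
  '[vsval x1 + vsval x2 + vsval x3, vsval y1 + vsval y2 + vsval y3] =
  '[x1, y1] + '[x2, y2] + '[x3, y3].
Proof.
have [a1 a2 a3] := adj_incl_sum x1 x2 x3.
by rewrite 2!linearDr /= -!inclE -!adjPl !inclE a1 a2 a3.
Qed.

Section Blocks.
Variables (a11 : 'Hom(subvs_of V1, subvs_of V1))
  (a12 : 'Hom(subvs_of V2, subvs_of V1)) (a13 : 'Hom(subvs_of V3, subvs_of V1))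
  (a21 : 'Hom(subvs_of V1, subvs_of V2)) (a22 : 'Hom(subvs_of V2, subvs_of V2))
  (a23 : 'Hom(subvs_of V3, subvs_of V2)) (a31 : 'Hom(subvs_of V1, subvs_of V3))
  (a32 : 'Hom(subvs_of V2, subvs_of V3)) (a33 : 'Hom(subvs_of V3, subvs_of V3)).

Lemma blockop3E (x1 : subvs_of V1) (x2 : subvs_of V2) (x3 : subvs_of V3) :
  blockop3 a11 a12 a13 a21 a22 a23 a31 a32 a33
    (vsval x1 + vsval x2 + vsval x3) =
  vsval (a11 x1 + a12 x2 + a13 x3) + vsval (a21 x1 + a22 x2 + a23 x3) +
  vsval (a31 x1 + a32 x2 + a33 x3).
Proof.
have [e1 e2 e3] := adj_incl_sum x1 x2 x3.
have liftE (V W : {vspace H}) (a : 'Hom(subvs_of W, subvs_of V)) u :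
    ((incl V \o a) \o adj (incl W))%VF u = vsval (a (adj (incl W) u)).
  by rewrite 2!comp_lfunE inclE.
by rewrite /blockop3 !add_lfunE !liftE e1 e2 e3 !linearD /=.
Qed.

End Blocks.

Lemma blockop3_eq (A : 'End(H)) a11 a12 a13 a21 a22 a23 a31 a32 a33 :
  [/\ block V1 V1 A = a11, block V1 V2 A = a12 & block V1 V3 A = a13] ->
  [/\ block V2 V1 A = a21, block V2 V2 A = a22 & block V2 V3 A = a23] ->
  [/\ block V3 V1 A = a31, block V3 V2 A = a32 & block V3 V3 A = a33] ->
  A = blockop3 a11 a12 a13 a21 a22 a23 a31 a32 a33.
Proof.
move=> [<- <- <-] [<- <- <-] [<- <- <-]; apply/lfunP => u.
have [x1 [x2 [x3 ->]]] := odecomp_split u.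
rewrite blockop3E !blockE -!linearD /=.
have [y1 [y2 [y3 ->]]] := odecomp_split (A (vsval x1 + vsval x2 + vsval x3)).
by have [-> -> ->] := adj_incl_sum y1 y2 y3.
Qed.

End OrthogonalDecomposition.

(** * The Schur complement decomposition *)

Section SchurComplement.
Variables (C : numClosedFieldType) (H : fdHilbertType C) (V1 V2 V3 : {vspace H}).
Variables (s0 : 'End(subvs_of V2)) (a : 'Hom(subvs_of V3, subvs_of V2)).
Variable b : 'End(subvs_of V3).
Hypothesis od : orthogonal_decomp V1 V2 V3.
Hypothesis s0_gt0 : strictly_positive s0.

Definition schur_ac : 'End(H) :=
  blockop3 (0 : 'End(subvs_of V1)) 0 0
           0 s0 a
           0 (adj a) (adj a \o s0^-1 \o a)%VF.

Definition schur_perp : 'End(H) :=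
  blockop3 (0 : 'End(subvs_of V1)) 0 0
           0 (0 : 'End(subvs_of V2)) 0
           0 0 (b - (adj a \o s0^-1 \o a)%VF).

Let T : 'End(H) :=
  blockop3 (0 : 'End(subvs_of V1)) 0 0
           0 s0 a
           0 (adj a) b.

Lemma schur_corner x : (adj a \o s0^-1 \o a)%VF x = adj a (s0^-1%VF (a x)).
Proof. by rewrite 2!comp_lfunE. Qed.

Lemma s0_mulV x : s0 (s0^-1%VF x) = x.
Proof. by rewrite lker0_lfunVK // strictly_positive_lker0. Qed.

(** The third row of the matrix is a^* s0^-1 times the second, so that the
vector x2 + s0^-1 (a x3) determines the whole value. *)
Lemma schur_acE (x1 : subvs_of V1) (x2 : subvs_of V2) (x3 : subvs_of V3) :
  schur_ac (vsval x1 + vsval x2 + vsval x3) =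
  vsval (0 : subvs_of V1) + vsval (s0 (x2 + s0^-1%VF (a x3)))
  + vsval (adj a (x2 + s0^-1%VF (a x3))).
Proof.
rewrite /schur_ac blockop3E // !zero_lfunE !add0r schur_corner.
by rewrite (linearD s0) (linearD (adj a)) /= s0_mulV.
Qed.

Lemma schur_perpE (x1 : subvs_of V1) (x2 : subvs_of V2) (x3 : subvs_of V3) :
  schur_perp (vsval x1 + vsval x2 + vsval x3) =
  vsval (0 : subvs_of V1) + vsval (0 : subvs_of V2)
  + vsval (b x3 - adj a (s0^-1%VF (a x3))).
Proof.
rewrite /schur_perp blockop3E // !zero_lfunE !add0r add_lfunE opp_lfunE.
by rewrite schur_corner.
Qed.

Lemma schur_decomp : T = schur_ac + schur_perp.
Proof.
apply/lfunP => u; have [x1 [x2 [x3 ->]]] := odecomp_split od u.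
rewrite add_lfunE schur_acE schur_perpE blockop3E // !zero_lfunE !add0r.
rewrite (linearD s0) (linearD (adj a)) /= s0_mulV.
rewrite -[RHS]addrA; congr (_ + _); rewrite -[RHS]addrA; congr (_ + _).
by rewrite addrC subrK.
Qed.

(** With y = x2 + s0^-1 (a x3) the quadratic form is
<s0 y, x2> + <a^* y, x3>, and the last term is <y, s0 (s0^-1 (a x3))>, so the
sum is <s0 y, y>. *)
Lemma schur_ac_positive : positive schur_ac.
Proof.
have s0_ge0 : positive s0.
  by move=> x; have [->|/s0_gt0/ltW//] := eqVneq x 0; rewrite linear0r.
move=> u; have [x1 [x2 [x3 ->]]] := odecomp_split od u.
rewrite schur_acE hdot_odecomp // linear0l add0r adjPl.
rewrite -{3}[a x3]s0_mulV -(positive_selfadj s0_ge0) -linearDr /=.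
exact: s0_ge0.
Qed.

(** These vectors, the graph of - s0^-1 a over V3, are the link between the three
operators: [schur_ac] vanishes there, so [T] and [schur_perp] agree. *)
Lemma schur_ac_ker (x3 : subvs_of V3) :
  schur_ac (vsval (0 : subvs_of V1) + vsval (- s0^-1%VF (a x3)) + vsval x3) = 0.
Proof. by rewrite schur_acE addNr !linear0 !addr0. Qed.

Lemma schur_perp_positive : positive T -> positive schur_perp.
Proof.
move=> T0 u; have [x1 [x2 [x3 ->]]] := odecomp_split od u.
have := T0 (vsval (0 : subvs_of V1) + vsval (- s0^-1%VF (a x3)) + vsval x3).
rewrite schur_decomp add_lfunE schur_ac_ker add0r !schur_perpE.
by rewrite !hdot_odecomp // !linear0l.
Qed.

(** An x3 of V3 lying in the support of [schur_ac] is orthogonal to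
(0, - s0^-1 (a x3), x3), which [schur_ac] kills; hence <x3, x3> = 0. *)
Lemma schur_ac_abs_cont rho :
  positive rho -> V3 = lker rho -> abs_cont schur_ac rho.
Proof.
move=> r0 V3E; apply/abs_contP => // x xS rx.
have xV : x \in V3 by rewrite V3E memv_ker rx.
pose x3 := vsproj V3 x.
have xE : x = vsval (0 : subvs_of V1) + vsval (0 : subvs_of V2) + vsval x3.
  by rewrite !linear0 !add0r vsprojK.
have : x3 = 0.
  apply: hdot_self_eq0.
  have /memv_orthovP := xS => /(_ _) xo.
  have := xo (vsval (0 : subvs_of V1) + vsval (- s0^-1%VF (a x3)) + vsval x3).
  rewrite memv_ker schur_ac_ker eqxx => /(_ isT).
  by rewrite {1}xE hdot_odecomp // !linear0l !add0r.
by move/(congr1 vsval); rewrite vsprojK.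
Qed.

Lemma schur_perp_singular rho : positive rho -> positive T ->
  supp rho = (V1 + V2)%VS -> singular schur_perp rho.
Proof.
move=> r0 T0 sE; apply/singularP => //; first exact: schur_perp_positive.
rewrite sE => x /memv_addP [u1 u1V [u2 u2V ->]].
have -> : u1 + u2 =
    vsval (vsproj V1 u1) + vsval (vsproj V2 u2) + vsval (0 : subvs_of V3).
  by rewrite !vsprojK // linear0 addr0.
by rewrite schur_perpE !linear0 !addr0.
Qed.

End SchurComplement.

(** * The decomposition of the space attached to rho and sigma *)

Section CanonicalDecomposition.
Variables (C : numClosedFieldType) (H : fdHilbertType C) (rho sigma : 'End(H)).
Hypotheses (r0 : positive rho) (sg0 : positive sigma).
Local Notation V1 := (H1 rho sigma).
Local Notation V2 := (H2 rho sigma).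
Local Notation V3 := (H3 rho).

Lemma H1E : V1 = (supp rho :&: lker sigma)%VS.
Proof.
apply/vspaceP => x; rewrite memv_cap memv_ker; apply/idP/andP.
  case/memv_imgP => y; rewrite memv_ker => /eqP ky ->; rewrite inclE subvsP.
  split=> //; apply/eqP/positive_isotropic => //.
  by rewrite -hdot_block -/(excision _ _) ky linear0l.
move=> [xS /eqP sx]; apply/memv_imgP; exists (vsproj (supp rho) x).
  by rewrite memv_ker /excision blockE vsprojK // sx linear0.
by rewrite inclE vsprojK.
Qed.

Lemma H2E : V2 = (supp rho :&: orthov hdot V1)%VS.
Proof.
apply/vspaceP => x; rewrite memv_cap; apply/idP/andP.
  case/memv_imgP => y /memv_orthovP yk ->; rewrite inclE subvsP.
  split=> //; apply/memv_orthovP => v /memv_imgP [k /yk yk0 ->].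
  by rewrite inclE.
move=> [xS /memv_orthovP xo]; apply/memv_imgP; exists (vsproj (supp rho) x).
  apply/memv_orthovP => k kK.
  (* The inner product of a subspace is, by definition, that of H. *)
  rewrite -[LHS]/('[vsval (vsproj (supp rho) x), vsval k]) vsprojK // xo //.
  by apply/memv_imgP; exists k; rewrite ?inclE.
by rewrite inclE vsprojK.
Qed.

Lemma supp_H12 : supp rho = (V1 + V2)%VS.
Proof.
apply/eqP; rewrite eqEsubv subv_add {2}H1E {2}H2E !capvSl !andbT.
apply/subvP => v vS; have [v1 [v2 [v1V v2V vE]]] := orthov_split V1 v.
apply/memv_addP; exists v1 => //; exists v2 => //.
rewrite H2E memv_cap v2V andbT -(addKr v1 v2) -vE addrC.
by rewrite rpredB //; move: v1V; rewrite H1E memv_cap => /andP[].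
Qed.

Lemma H123_odecomp : orthogonal_decomp V1 V2 V3.
Proof.
have o3 : {in supp rho & V3, forall u v, '[u, v] = 0}.
  by move=> u v /memv_orthovP; apply.
split.
- apply/vspaceP => u; rewrite memvf -supp_H12.
  have [v [w [vS rw ->]]] := supp_split rho u.
  by rewrite memv_add // memv_ker rw.
- move=> u v uV; rewrite H2E memv_cap => /andP[_ /memv_orthovP vo].
  by apply: hdot_eq0C; apply: vo.
- by move=> u v; rewrite {1}H1E memv_cap => /andP[uS _]; apply: o3.
- by move=> u v; rewrite {1}H2E memv_cap => /andP[uS _]; apply: o3.
Qed.

Lemma block_ker_r (V W : {vspace H}) A :
  (W <= lker A)%VS -> block V W A = 0.
Proof.
move=> /subvP WK; apply/lfunP => x; rewrite blockE zero_lfunE.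
by have /eqP -> : A (vsval x) == 0; rewrite ?linear0 // -memv_ker WK ?subvsP.
Qed.

Lemma block_ker_l (V W : {vspace H}) A :
  positive A -> (V <= lker A)%VS -> block V W A = 0.
Proof.
move=> A0 VK; rewrite -(adj_block _ _ (positive_selfadj A0)) block_ker_r //.
by apply: adj_unique => x y; rewrite !zero_lfunE linear0l linear0r.
Qed.

Lemma rho_blockE : rho =
  blockop3 (block V1 V1 rho) (block V1 V2 rho) 0
           (adj (block V1 V2 rho)) (block V2 V2 rho) 0
           0 0 (0 : 'End(subvs_of V3)).
Proof.
apply: blockop3_eq; first exact: H123_odecomp.
- by split; rewrite // block_ker_r.
- by split; rewrite ?(adj_block _ _ (positive_selfadj r0)) // block_ker_r.
- by split; rewrite block_ker_l.
Qed.

Lemma sigma_blockE : sigma =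
  blockop3 (0 : 'End(subvs_of V1)) 0 0
           0 (block V2 V2 sigma) (block V2 V3 sigma)
           0 (adj (block V2 V3 sigma)) (block V3 V3 sigma).
Proof.
have V1K : (V1 <= lker sigma)%VS by rewrite H1E capvSr.
apply: blockop3_eq; first exact: H123_odecomp.
- by split; rewrite block_ker_l.
- by split; rewrite // block_ker_r.
- by split; rewrite ?(adj_block _ _ (positive_selfadj sg0)) // block_ker_r.
Qed.

(** A vector of H2 that sigma kills lies in H1, which is orthogonal to H2. *)
Lemma sigma0_gt0 : strictly_positive (block V2 V2 sigma).
Proof.
move=> x x0; rewrite hdot_block lt_def sg0 andbT; apply: contraNneq x0 => sx.
have [_ o12 _ _] := H123_odecomp.
have xS : vsval x \in supp rho.
  by rewrite supp_H12 memvE (subv_trans _ (addvSr _ _)) // -memvE subvsP.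
apply/eqP/hdot_self_eq0/(o12 (vsval x) (vsval x)); last exact: subvsP.
by rewrite H1E memv_cap xS memv_ker (positive_isotropic sg0 sx) eqxx.
Qed.

(** The form of this 2 x 2 block operator at (x1, x2) is <rho v, v> with
v = x1 + x2, a vector of supp rho that vanishes only if x1 = x2 = 0. *)
Lemma rho_corner_gt0 :
  strictly_positive (blockop2 (block V1 V1 rho) (block V1 V2 rho)
                       (adj (block V1 V2 rho)) (block V2 V2 rho)).
Proof.
move=> [x1 x2] x0.
have [_ o12 _ _] := H123_odecomp.
set v := vsval x1 + vsval x2.
have <- : '[rho v, v] = '[blockop2 (block V1 V1 rho) (block V1 V2 rho)
    (adj (block V1 V2 rho)) (block V2 V2 rho) (x1, x2), (x1, x2)].
  rewrite blockop2E -[RHS]/('[_, x1] + '[_, x2]) /=.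
  rewrite (adj_block _ _ (positive_selfadj r0)) !linearDl /= !hdot_block.
  by rewrite -!linearDl -linearDr /= -linearD.
apply: hdot_positive_supp => //.
  by rewrite supp_H12 memv_add ?subvsP.
apply: contraNneq x0 => v0.
have := hdot_odecomp H123_odecomp x1 x1 x2 x2 0 0.
rewrite !linear0 !addr0 -/v v0 linear0l => /esym/eqP.
rewrite paddr_eq0 ?dnorm_ge0 // !dnorm_eq0 => /andP[/eqP -> /eqP ->].
by [].
Qed.

End CanonicalDecomposition.

Theorem lemma3p3 (R : realType) (H : fdHilbertType R[i]) (rho sigma : 'End(H)) :
  positive rho -> positive sigma -> ~ singular sigma rho ->
  let V1 := H1 rho sigma in
  let V2 := H2 rho sigma in
  let V3 := H3 rho in
  let rho2 := block V1 V1 rho in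
  let rho1 := block V1 V2 rho in
  let rho0 := block V2 V2 rho in
  let sigma0 := block V2 V2 sigma in
  let alpha := block V2 V3 sigma in
  let beta := block V3 V3 sigma in
  [/\ orthogonal_decomp V1 V2 V3,
      rho = blockop3 rho2       rho1 0
                     (adj rho1) rho0 0
                     0          0    (0 : 'End(subvs_of V3)),
      sigma = blockop3 (0 : 'End(subvs_of V1)) 0           0
                       0                       sigma0      alpha
                       0                       (adj alpha) beta,
      strictly_positive (blockop2 rho2       rho1
                                  (adj rho1) rho0)
    & strictly_positive sigma0]
  /\
  forall sigma_ac sigma_perp : 'End(H),
    [/\ positive sigma_ac, positive sigma_perp,
        sigma = sigma_ac + sigma_perp,
        abs_cont sigma_ac rho & singular sigma_perp rho]
    <->
    sigma_ac =
      blockop3 (0 : 'End(subvs_of V1)) 0           0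
               0                       sigma0      alpha
               0                       (adj alpha) (adj alpha \o sigma0^-1 \o alpha)%VF
    /\ sigma_perp =
      blockop3 (0 : 'End(subvs_of V1)) 0                        0
               0                       (0 : 'End(subvs_of V2))  0
               0                       0 (beta - (adj alpha \o sigma0^-1 \o alpha)%VF).
Proof.
move=> r0 sg0 _ V1 V2 V3 rho2 rho1 rho0 sigma0 alpha beta.
have od : orthogonal_decomp V1 V2 V3 by exact: H123_odecomp.
have sE := sigma_blockE rho sg0.
have s0 : strictly_positive sigma0 by exact: sigma0_gt0.
split; first by split=> //; [exact: rho_blockE | exact: rho_corner_gt0].
pose ac := schur_ac V1 sigma0 alpha.
pose perp := schur_perp V1 sigma0 alpha beta.
have dec : sigma = ac + perp by rewrite -schur_decomp.
have T0 := sg0; rewrite sE in T0.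
have ac0 : positive ac by apply: schur_ac_positive.
have perp0 : positive perp by apply: schur_perp_positive.
have acC : abs_cont ac rho by apply: schur_ac_abs_cont.
have perpS : singular perp rho by apply: schur_perp_singular => //; exact: supp_H12.
move=> a p; rewrite -/ac -/perp; split=> [[a0 p0 e aC pS]|[-> ->]]; last by split.
have ea : a = ac.
  by apply: (lebesgue_unique r0 a0 p0 aC pS ac0 perp0 acC perpS); rewrite -e.
by split=> //; apply: (addrI a); rewrite -e dec ea.
Qed.
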